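(* Let $X$ be a Banach space, let $\Gamma$ be a set, and let $Q:\ell_1(\Gamma)\to X$ be a quotient map. Then $\operatorname{Ext}^2(X,X^* )=0$ if and only if every continuous bilinear form $b:\ker Q\times\ker Q\to\mathbb{R}$ can be extended to a continuous bilinear form $B:\ell_1(\Gamma)\times\ell_1(\Gamma)\to\mathbb{R}$.
   Context: All spaces are (real) Banach spaces and all operators are continuous and linear. A quotient map is a surjective operator. A short exact sequence $0\to Y\to E\to X\to 0$ is a diagram of Banach spaces and operators in which the kernel of each arrow equals the image of the preceding one. The space $\operatorname{Ext}^2(X,Y)$ consists of concatenations $FG$ of short exact sequences $F: 0\to Y\to A\to B\to 0$ and $G: 0\to B\to C\to X\to 0$ of Banach spaces, modulo the equivalence relation generated by $FG\to F'G'$, where $FG\to F'G'$ means that there are operators $A\to A'$, $B\to B'$, $C\to C'$ which, together with the identities of $Y$ and $X$, form a commutative diagram from $Y\to A\to B\to C\to X$ to $Y\to A'\to B'\to C'\to X$. The element $FG$ is said to be $0$ if there exist a Banach space $E$ and short exact sequences $0\to Y\to E\to C\to 0$ and $0\to A\to E\to X\to 0$ such that the diagram with exact columns $0\to Y\to A\to B\to 0$ (which is $F$) and $0\to Y\to E\to C\to 0$, and exact rows $0\to A\to E\to X\to 0$ and $0\to B\to C\to X\to 0$ (which is $G$), is commutative, with the identity maps on $Y$ and on $X$. One writes $\operatorname{Ext}^2(X,Y)=0$ when all elements of $\operatorname{Ext}^2(X,Y)$ are $0$. *)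

(* Defs.v *)
From HB Require Import structures.
From Stdlib Require Import Relation_Operators.
From mathcomp Require Import all_boot all_order all_algebra.
From mathcomp Require Import finmap all_classical all_reals all_analysis.

Set Implicit Arguments.
Unset Strict Implicit.
Unset Printing Implicit Defensive.

Import Order.TTheory GRing.Theory Num.Theory.
Import numFieldNormedType.Exports.

Local Open Scope classical_set_scope.
Local Open Scope ring_scope.

#[short(type="operator")]
HB.structure Definition Operator (R : realType) (X Y : normedModType R) :=
  {f of @GRing.Linear R X Y *:%R f & @isContinuous X Y f}.

Section completeness.
Context {R : realType} {V : normedModType R}.

Lemma cauchy_dist (F : set_system V) : ProperFilter F -> cauchy F ->
  forall e : R, 0 < e -> \forall u \near F, \forall v \near F, `|u - v| <= e.
Proof.
move=> FF /cauchy_ballP Fc e e0.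
have /nearP_dep := Fc e e0; apply: filterS => u.
by apply: filterS => v; rewrite -ball_normE /= => /ltW.
Qed.

Lemma cauchy_cvg_of (F : set_system V) (l : V) : ProperFilter F -> cauchy F ->
  (forall (u : V) (e : R), 0 < e ->
     (\forall v \near F, `|u - v| <= e) -> `|u - l| <= e) -> cvg F.
Proof.
move=> FF Fc H; apply/cvg_ex; exists l; apply/(@cvgrPdist_le _ _ _ F _ id) => e e0.
have := cauchy_dist FF Fc e0; apply: filterS => u ul.
by rewrite distrC; exact: H.
Qed.

Lemma cauchy_cvg_lipschitz (W : completeNormedModType R) (F : set_system V)
    (p : V -> W) (C : R) : ProperFilter F -> cauchy F ->
  (forall u v, `|p u - p v| <= C * `|u - v|) -> cvg (p @ F).
Proof.
move=> FF Fc pC; apply/cauchy_cvgP/cauchy_exP => e e0.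
have C0 : 0 < `|C| + 1 by rewrite ltr_wpDl.
have [u Fu] := filter_ex (cauchy_dist FF Fc (divr_gt0 (divr_gt0 e0 (@ltr0Sn R 1)) C0)).
exists (p u); apply: filterS Fu => v uv; rewrite /=.
rewrite -ball_normE /=; apply: (le_lt_trans (pC u v)).
rewrite (@le_lt_trans _ _ ((`|C| + 1) * `|u - v|))//.
  by rewrite ler_wpM2r// (le_trans (ler_norm _))// lerDl.
rewrite (le_lt_trans (ler_wpM2l (ltW C0) uv))// mulrC divfK ?gt_eqF//.
by rewrite ltr_pdivrMr// ltr_pMr// ltr1n.
Qed.

Lemma lim_dist_le (T : Type) (F : set_system T) (p : T -> V) (a l : V) (e : R) :
  ProperFilter F -> p @ F --> l -> (\forall t \near F, `|a - p t| <= e) ->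
  `|a - l| <= e.
Proof.
move=> FF pl; have : (fun t => `|a - p t|) @ F --> `|a - l|.
  by apply: cvg_norm; apply: cvgB => //; exact: cvg_cst.
exact: cvgr_to_le.
Qed.

End completeness.

Section kernel.
Context {R : realType} {X Y : normedModType R}.

Definition opker_pred (f : operator X Y) : {pred X} := [pred x | f x == 0].

Lemma opker_submod_closed (f : operator X Y) : submod_closed (opker_pred f).
Proof.
split=> [|a x y]; rewrite !inE ?linear0// => /eqP fx /eqP fy.
by apply/eqP; rewrite linearP /= fx fy scaler0 addr0.
Qed.

HB.instance Definition _ (f : operator X Y) :=
  GRing.isSubmodClosed.Build R X (opker_pred f) (opker_submod_closed f).

Record opker (f : operator X Y) :=
  Opker { opker_val :> X; opker_valP : opker_val \in opker_pred f }.

HB.instance Definition _ (f : operator X Y) := [isSub for @opker_val f].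
HB.instance Definition _ (f : operator X Y) := [Choice of opker f by <:].
HB.instance Definition _ (f : operator X Y) :=
  [SubChoice_isSubLmodule of opker f by <:].

Section norm.
Variable f : operator X Y.

Definition opker_norm (x : opker f) : R := `|\val x|.

Lemma opker_normD x y : opker_norm (x + y) <= opker_norm x + opker_norm y.
Proof. by rewrite /opker_norm raddfD ler_normD. Qed.

Lemma opker_normZ a x : opker_norm (a *: x) = `|a| * opker_norm x.
Proof. by rewrite /opker_norm linearZ normrZ. Qed.

Lemma opker_norm0_eq0 x : opker_norm x = 0 -> x = 0.
Proof. by move=> /normr0_eq0 x0; apply: val_inj; rewrite x0 raddf0. Qed.

HB.instance Definition _ :=
  @Lmodule_isNormed.Build R (opker f) opker_norm opker_normD opker_normZ
    opker_norm0_eq0.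

Lemma opker_normE (x : opker f) : `|x| = `|\val x|. Proof. by []. Qed.

End norm.
End kernel.

Section opker_complete.
Context {R : realType} {X : completeNormedModType R} {Y : normedModType R}.
Variable f : operator X Y.

Lemma opker_complete (F : set_system (opker f)) :
  ProperFilter F -> cauchy F -> cvg F.
Proof.
move=> FF Fc; pose p : opker f -> X := val.
have pl : cvg (p @ F).
  apply: (@cauchy_cvg_lipschitz _ _ _ _ p 1 FF Fc) => u v.
  by rewrite mul1r /p -raddfB.
set l := lim (p @ F) in pl.
have fl0 : l \in opker_pred f.
  rewrite inE; apply/eqP.
  have fl : (f \o p) @ F --> f l by apply: continuous_cvg => //; exact: cts_fun.
  apply: (@norm_cvg_unique _ _ _ _ _ _ fl).
  rewrite (_ : f \o p = cst 0); first exact: cvg_cst.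
  by apply/funext => x /=; apply/eqP; have := opker_valP x; rewrite inE.
apply: (@cauchy_cvg_of _ _ F (Opker fl0) FF Fc) => u e e0 ue.
rewrite opker_normE raddfB /=; apply: (lim_dist_le FF pl).
by apply: filterS ue => v; rewrite opker_normE raddfB.
Qed.

HB.instance Definition _ := Uniform_isComplete.Build (opker f) opker_complete.
End opker_complete.

Section dual.
Context {R : realType} {V : normedModType R}.

Definition dual_pred : {pred V -> R} :=
  mem [set f : V -> R | linear f /\ continuous f].

Lemma dual_submod_closed : submod_closed dual_pred.
Proof.
split=> [|a f g]; rewrite !inE /=.
  split; last by move=> x; exact: cvg_cst.
  by move=> a x y; rewrite /= scaler0 addr0.
move=> -[lf cf] [lg cg]; split.
  move=> k x y /=; rewrite !fctE lf lg.
  by rewrite scalerDr scalerDr !scalerA mulrC addrACA.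
by move=> x; apply: cvgD; [apply: cvgZr; exact: cf|exact: cg].
Qed.

HB.instance Definition _ :=
  GRing.isSubmodClosed.Build R (V -> R) dual_pred dual_submod_closed.

End dual.
Arguments dual_pred {R} V.

Record dual (R : realType) (V : normedModType R) :=
  Dual { dual_fun :> V -> R; dual_funP : dual_fun \in dual_pred V }.

HB.instance Definition _ (R : realType) (V : normedModType R) :=
  [isSub for @dual_fun R V].
HB.instance Definition _ (R : realType) (V : normedModType R) :=
  [Choice of dual V by <:].
HB.instance Definition _ (R : realType) (V : normedModType R) :=
  [SubChoice_isSubLmodule of dual V by <:].

Section dual_norm.
Context {R : realType} {V : normedModType R}.
Implicit Types f g : dual V.

Definition dual_norm f : R := sup [set `|f x| | x in [set x : V | `|x| <= 1]].

Lemma dual_linear f : linear f.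
Proof. by have := dual_funP f; rewrite inE => -[]. Qed.

Lemma dual_continuous f : continuous f.
Proof. by have := dual_funP f; rewrite inE => -[]. Qed.

HB.instance Definition _ f :=
  GRing.isLinear.Build R V R *:%R (dual_fun f) (dual_linear f).
HB.instance Definition _ f :=
  isContinuous.Build V R (dual_fun f) (@dual_continuous f).

Lemma dualD f g x : (f + g) x = f x + g x. Proof. by []. Qed.
Lemma dualB f g x : (f - g) x = f x - g x. Proof. by []. Qed.
Lemma dualZ a f x : (a *: f) x = a * f x. Proof. by []. Qed.

Lemma dual_bounded f : exists M : R, forall x, `|f x| <= M * `|x|.
Proof.
have /linear_bounded_continuous/linear_boundedP :
  continuous (f : {linear V -> R}) by exact: dual_continuous.
by move=> /pinfty_ex_gt0[M _ fM]; exists M.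
Qed.

Lemma dual_norm_has_sup f :
  has_sup [set `|f x| | x in [set x : V | `|x| <= 1]].
Proof.
split; first by exists `|f 0|, 0 => //=; rewrite normr0.
have [M fM] := dual_bounded f; exists `|M| => _ [x /= x1 <-].
rewrite (le_trans (fM x))// (le_trans (ler_wpM2r _ (ler_norm M)))//.
by rewrite ler_piMr.
Qed.

Lemma dual_norm_le f (M : R) :
  (forall x, `|x| <= 1 -> `|f x| <= M) -> dual_norm f <= M.
Proof.
move=> fM; apply: ge_sup; first exact: (dual_norm_has_sup f).1.
by move=> _ [x /= x1 <-]; exact: fM.
Qed.

Lemma le_dual_norm f x : `|f x| <= dual_norm f * `|x|.
Proof.
have [->|x0] := eqVneq x 0; first by rewrite linear0 !normr0 mulr0.
have nx0 : 0 < `|x| by rewrite normr_gt0.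
rewrite -ler_pdivrMr// mulrC -[X in X * _]ger0_norm ?invr_ge0//.
rewrite -normrM -[_ * f x]/(_ *: f x) -linearZ.
apply: (sup_upper_bound (dual_norm_has_sup f)).
by exists (`|x|^-1 *: x) => //=; rewrite normfZV.
Qed.

Lemma dual_norm_ge0 f : 0 <= dual_norm f.
Proof.
apply: (le_trans (normr_ge0 (f 0))).
apply: (sup_upper_bound (dual_norm_has_sup f)).
by exists 0 => //=; rewrite normr0.
Qed.

Lemma dual_normD f g : dual_norm (f + g) <= dual_norm f + dual_norm g.
Proof.
apply: dual_norm_le => x x1; rewrite dualD (le_trans (ler_normD _ _))//.
rewrite lerD//; apply: (le_trans (le_dual_norm _ _));
  by rewrite ler_piMr// dual_norm_ge0.
Qed.

Lemma dual_normZ a f : dual_norm (a *: f) = `|a| * dual_norm f.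
Proof.
have le b g : dual_norm (b *: g) <= `|b| * dual_norm g.
  apply: dual_norm_le => x x1; rewrite dualZ normrM ler_wpM2l//.
  by rewrite (le_trans (le_dual_norm _ _))// ler_piMr// dual_norm_ge0.
apply/eqP; rewrite eq_le le /=.
have [->|a0] := eqVneq a 0; first by rewrite normr0 mul0r dual_norm_ge0.
rewrite -ler_pdivlMl ?normr_gt0// -normfV.
by apply: le_trans (le _ _); rewrite scalerA mulVf// scale1r.
Qed.

Lemma dual_norm0_eq0 f : dual_norm f = 0 -> f = 0.
Proof.
move=> f0; apply: val_inj; apply/funext => x /=; apply/eqP.
by rewrite -normr_le0 (le_trans (le_dual_norm f x))// f0 mul0r.
Qed.

HB.instance Definition _ :=
  @Lmodule_isNormed.Build R (dual V) dual_norm dual_normD dual_normZ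
    dual_norm0_eq0.

Lemma dual_normE f : `|f| = dual_norm f. Proof. by []. Qed.

Lemma dual_complete (F : set_system (dual V)) :
  ProperFilter F -> cauchy F -> cvg F.
Proof.
move=> FF Fc; pose ev (x : V) (f : dual V) : R := f x.
have evB x f g : `|ev x f - ev x g| <= `|x| * `|f - g|.
  by rewrite mulrC; exact: (le_dual_norm (f - g) x).
have evl x : cvg (ev x @ F).
  exact: (cauchy_cvg_lipschitz FF Fc (evB x)).
pose l x : R := lim (ev x @ F).
have llin : linear l.
  move=> a x y; apply: (@norm_cvg_unique _ _ _ _ _ _ (evl _)).
  rewrite (_ : ev _ = (fun f => a *: ev x f + ev y f)); last first.
    by apply/funext => f; rewrite /ev linearP.
  by apply: cvgD; [apply: cvgZr; exact: evl|exact: evl].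
pose L : {linear V -> R} := HB.pack l (GRing.isLinear.Build _ _ _ _ _ llin).
have lcont : continuous l.
  apply: (@bounded_linear_continuous _ _ _ L).
  have [u Fu] := filter_ex (cauchy_dist FF Fc (@ltr01 R)).
  apply/bounded_funP => r; exists (`|u| * r + r) => x xr.
  rewrite -[L x]/(l x) -[l x](subrK (u x)) addrC.
  rewrite (le_trans (ler_normD _ _))// lerD//.
    by rewrite (le_trans (le_dual_norm u x))// ler_wpM2l// dual_norm_ge0.
  rewrite distrC; apply: (lim_dist_le FF (evl x)).
  apply: filterS Fu => v uv; apply: (le_trans (evB x u v)).
  by rewrite (le_trans _ xr)// ler_piMr.
have ldual : l \in dual_pred V by rewrite inE.
apply: (@cauchy_cvg_of _ _ F (Dual ldual) FF Fc) => u e e0 ue.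
apply: dual_norm_le => x x1; rewrite dualB /=.
apply: (lim_dist_le FF (evl x)).
apply: filterS ue => v uv; apply: (le_trans (evB x u v)).
by rewrite (le_trans _ uv)// ler_piMl.
Qed.

HB.instance Definition _ := Uniform_isComplete.Build (dual V) dual_complete.

End dual_norm.

Section ell1_pred.
Context {R : realType} {Gamma : choiceType}.

Definition ell1_pred : {pred Gamma -> R} :=
  mem [set f : Gamma -> R | summable [set: Gamma] (EFin \o f)].

Lemma ell1_predP (f : Gamma -> R) : f \in ell1_pred <->
  exists M : R, forall A, finite_set A -> \sum_(i \in A) `|f i| <= M.
Proof.
rewrite inE /=; split=> [|[M fM]].
  rewrite summableE => ffin.
  exists (fine (\esum_(i in [set: Gamma]) `|(f i)%:E|%E)) => A finA.
  rewrite -lee_fin fineK// -fsumEFin//.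
  by apply: ereal_sup_ubound; exists A.
apply: (@le_lt_trans _ _ M%:E); last exact: ltry.
apply: ge_ereal_sup => _ [A [finA _] <-].
by rewrite /= fsumEFin// lee_fin fM.
Qed.

Lemma fsumZD_le (a : R) (f g : Gamma -> R) (A : set Gamma) : finite_set A ->
  \sum_(i \in A) `|a * f i + g i| <=
  `|a| * \sum_(i \in A) `|f i| + \sum_(i \in A) `|g i|.
Proof.
move=> finA; rewrite !fsbig_finite// mulr_sumr -big_split /=.
by apply: ler_sum => i _; rewrite (le_trans (ler_normD _ _))// normrM.
Qed.

Lemma ell1_submod_closed : submod_closed ell1_pred.
Proof.
split=> [|a f g].
  apply/ell1_predP; exists 0 => A finA.
  by rewrite fsbig_finite// big1// => i _; rewrite normr0.
move=> /ell1_predP[M fM] /ell1_predP[N gN]; apply/ell1_predP.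
exists (`|a| * M + N) => A finA; apply: (le_trans (fsumZD_le a f g finA)).
by rewrite lerD ?gN// ler_wpM2l// fM.
Qed.

HB.instance Definition _ :=
  GRing.isSubmodClosed.Build R (Gamma -> R) ell1_pred ell1_submod_closed.

End ell1_pred.
Arguments ell1_pred R Gamma : clear implicits.

Record ell1 (R : realType) (Gamma : choiceType) :=
  Ell1 { ell1_fun :> Gamma -> R; ell1_funP : ell1_fun \in ell1_pred R Gamma }.

HB.instance Definition _ (R : realType) (Gamma : choiceType) :=
  [isSub for @ell1_fun R Gamma].
HB.instance Definition _ (R : realType) (Gamma : choiceType) :=
  [Choice of ell1 R Gamma by <:].
HB.instance Definition _ (R : realType) (Gamma : choiceType) :=
  [SubChoice_isSubLmodule of ell1 R Gamma by <:].

Section ell1_norm.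
Context {R : realType} {Gamma : choiceType}.
Implicit Types f g : ell1 R Gamma.

Definition ell1_norm f : R := fine (\esum_(i in [set: Gamma]) `|(f i)%:E|%E).

Lemma ell1_fsum_le f (A : set Gamma) : finite_set A ->
  \sum_(i \in A) `|f i| <= ell1_norm f.
Proof.
move=> finA; have := ell1_funP f; rewrite inE /= summableE => ffin.
rewrite -lee_fin /ell1_norm fineK// -fsumEFin//.
by apply: ereal_sup_ubound; exists A.
Qed.

Lemma ell1_norm_le f (M : R) :
  (forall A, finite_set A -> \sum_(i \in A) `|f i| <= M) -> ell1_norm f <= M.
Proof.
have := ell1_funP f; rewrite inE /= summableE => ffin fM.
rewrite -lee_fin /ell1_norm fineK//; apply: ge_ereal_sup => _ [A [finA _] <-].
by rewrite /= fsumEFin// lee_fin fM.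
Qed.

Lemma ell1D f g i : (f + g) i = f i + g i. Proof. by []. Qed.
Lemma ell1B f g i : (f - g) i = f i - g i. Proof. by []. Qed.
Lemma ell1Z a f i : (a *: f) i = a * f i. Proof. by []. Qed.

Lemma le_ell1_norm f i : `|f i| <= ell1_norm f.
Proof. by have := ell1_fsum_le f (finite_set1 i); rewrite fsbig_set1. Qed.

Lemma ell1_norm_ge0 f : 0 <= ell1_norm f.
Proof. by have := ell1_fsum_le f (finite_set0 _); rewrite fsbig_set0. Qed.

Lemma ell1_normD f g : ell1_norm (f + g) <= ell1_norm f + ell1_norm g.
Proof.
apply: ell1_norm_le => A finA.
have := fsumZD_le 1 f g finA; rewrite normr1 mul1r.
under eq_fsbigr do rewrite mul1r.
by move/le_trans; apply; rewrite lerD// ell1_fsum_le.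
Qed.

Lemma ell1_normZ a f : ell1_norm (a *: f) = `|a| * ell1_norm f.
Proof.
have le b g : ell1_norm (b *: g) <= `|b| * ell1_norm g.
  apply: ell1_norm_le => A finA; apply: le_trans (ler_wpM2l _ (ell1_fsum_le g finA)) => //.
  by rewrite !fsbig_finite// mulr_sumr ler_sum// => i _; rewrite ell1Z normrM.
apply/eqP; rewrite eq_le le /=.
have [->|a0] := eqVneq a 0; first by rewrite normr0 mul0r ell1_norm_ge0.
rewrite -ler_pdivlMl ?normr_gt0// -normfV.
by apply: le_trans (le _ _); rewrite scalerA mulVf// scale1r.
Qed.

Lemma ell1_norm0_eq0 f : ell1_norm f = 0 -> f = 0.
Proof.
move=> f0; apply: val_inj; apply/funext => i /=; apply/eqP.
by rewrite -normr_le0 -f0 le_ell1_norm.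
Qed.

HB.instance Definition _ :=
  @Lmodule_isNormed.Build R (ell1 R Gamma) ell1_norm ell1_normD ell1_normZ
    ell1_norm0_eq0.

Lemma ell1_normE f : `|f| = ell1_norm f. Proof. by []. Qed.

Lemma ell1_complete (F : set_system (ell1 R Gamma)) :
  ProperFilter F -> cauchy F -> cvg F.
Proof.
move=> FF Fc; pose ev (i : Gamma) (f : ell1 R Gamma) : R := f i.
have evl i : cvg (ev i @ F).
  apply: (@cauchy_cvg_lipschitz _ _ _ _ (ev i) 1 FF Fc) => f g.
  by rewrite mul1r; exact: (le_ell1_norm (f - g) i).
pose l i : R := lim (ev i @ F).
have lB (u : ell1 R Gamma) (e : R) : (\forall v \near F, `|u - v| <= e) ->
    forall A, finite_set A -> \sum_(i \in A) `|u i - l i| <= e.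
  move=> ue A finA.
  have : (fun v : ell1 R Gamma => \sum_(i <- fset_set A) `|u i - ev i v|) @ F
      --> \sum_(i <- fset_set A) `|u i - l i|.
    apply: cvg_big => [|i _]; first exact: add_continuous.
    by apply: cvg_norm; apply: cvgB; [exact: cvg_cst|exact: evl].
  rewrite fsbig_finite//; move/cvgr_to_le; apply.
  apply: filterS ue => v; apply: le_trans.
  by have := ell1_fsum_le (u - v) finA; rewrite fsbig_finite.
have lell1 : l \in ell1_pred R Gamma.
  have [u Fu] := filter_ex (cauchy_dist FF Fc (@ltr01 R)).
  apply/ell1_predP; exists (1 + `|u|) => A finA.
  have := fsumZD_le (- 1) (fun i => u i - l i) u finA.
  under eq_fsbigr do rewrite mulN1r opprB subrK.
  rewrite normrN normr1 mul1r => /le_trans; apply.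
  by rewrite lerD ?ell1_fsum_le// lB.
apply: (@cauchy_cvg_of _ _ F (Ell1 lell1) FF Fc) => u e e0 ue.
by apply: ell1_norm_le => A finA; exact: lB.
Qed.

HB.instance Definition _ :=
  Uniform_isComplete.Build (ell1 R Gamma) ell1_complete.

End ell1_norm.

Section ext2.
Context {R : realType}.
Implicit Types X Y E : completeNormedModType R.

(* Exactness of 0 -> Y -> E -> X -> 0 at Y, at E and at X. *)
Definition short_exact Y E X (i : operator Y E) (q : operator E X) : Prop :=
  [/\ i @^-1` [set 0] = [set 0],
      range i = q @^-1` [set 0] &
      range q = [set: X]].

Record ses Y X := Ses {
  ses_mid : completeNormedModType R;
  ses_in : operator Y ses_mid;
  ses_out : operator ses_mid X;
  ses_exact : short_exact ses_in ses_out }.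

(* [concat X Y]: concatenations FG of F = concat_l : 0 -> Y -> A -> B -> 0 and
   G = concat_r : 0 -> B -> C -> X -> 0, where B = concat_mid. *)
Record concat X Y := Concat {
  concat_mid : completeNormedModType R;
  concat_l : ses Y concat_mid;
  concat_r : ses concat_mid X }.

Definition concat_map X Y (S T : concat X Y) : Prop :=
  exists (a : operator (ses_mid (concat_l S)) (ses_mid (concat_l T)))
         (b : operator (concat_mid S) (concat_mid T))
         (c : operator (ses_mid (concat_r S)) (ses_mid (concat_r T))),
  [/\ a \o ses_in (concat_l S) = ses_in (concat_l T),
      b \o ses_out (concat_l S) = ses_out (concat_l T) \o a,
      c \o ses_in (concat_r S) = ses_in (concat_r T) \o b &
      ses_out (concat_r S) = ses_out (concat_r T) \o c :> (_ -> _)].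

Definition concat_equiv X Y : concat X Y -> concat X Y -> Prop :=
  clos_refl_sym_trans _ (@concat_map X Y).

(* Elements of Ext2 are equivalence classes of [concat_equiv].  The class is a
   bare predicate and its defining property a pointwise equivalence, because
   [concat X Y] lives in a universe too large for [set]. *)
Record Ext2 X Y := MkExt2 {
  Ext2_rep : concat X Y -> Prop;
  Ext2_repP : exists S, forall T, Ext2_rep T <-> concat_equiv S T }.

Lemma Ext2_class_subproof X Y (S : concat X Y) :
  exists S', forall T, concat_equiv S T <-> concat_equiv S' T.
Proof. by exists S. Qed.

Definition Ext2_class X Y (S : concat X Y) : Ext2 X Y :=
  MkExt2 (Ext2_class_subproof S).

(* The diagram has columns Y -> A -> B and Y -(u)-> E -(r)-> C, and rows
   A -(v)-> E -(s)-> X and B -> C -> X. *)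
Definition concat_null X Y (S : concat X Y) : Prop :=
  exists (E : completeNormedModType R)
         (u : operator Y E) (r : operator E (ses_mid (concat_r S)))
         (v : operator (ses_mid (concat_l S)) E) (s : operator E X),
  [/\ short_exact u r, short_exact v s,
      v \o ses_in (concat_l S) = u,
      r \o v = ses_in (concat_r S) \o ses_out (concat_l S) &
      ses_out (concat_r S) \o r = s].

(* Being null is a condition on the concatenation FG itself; it is imposed on
   every representative, so that "FG is 0" has its literal meaning without
   appealing to invariance under [concat_equiv] (see [Ext2_eq0P]). *)
Definition Ext2_null X Y (e : Ext2 X Y) : Prop :=
  forall S, Ext2_rep e S -> concat_null S.

Definition Ext2_eq0 X Y : Prop := forall e : Ext2 X Y, Ext2_null e.

Lemma Ext2_eq0P X Y : Ext2_eq0 X Y <-> forall S : concat X Y, concat_null S.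
Proof.
split=> [h S|h e S _]; last exact: h.
exact: (h (Ext2_class S)) (rst_refl _ _ S).
Qed.

End ext2.

(* Main.v *)
Require Import Defs.
From HB Require Import structures.
From mathcomp Require Import all_boot all_order all_algebra.
From mathcomp Require Import finmap all_classical all_reals all_analysis.
From mathcomp Require summability.
From mathcomp Require Import ring lra.

(* Write [L = ell1 R Gamma] and [K = ker Q].  Dualizing [0 -> K -> L -> X -> 0]
   gives, by Hahn-Banach, the exact sequence [0 -> X^* -> L^* -> K^* -> 0]; here
   [L] is projective (operators lift through quotient maps) and [L^*] is
   injective.  Bounded bilinear forms on [U * V] are operators [U -> V^*].

   If Ext2(X, X^* ) = 0, a form [tau : K -> K^*] yields the concatenation of
   its pullback [0 -> X^* -> A -> K -> 0] with [0 -> K -> L -> X -> 0].  Nullity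
   gives [A -> E -> X] and a quotient map [E -> L], which has a section
   [L -> E]; the projection [A -> L^*] extends to [E -> L^*], and the composite
   [L -> E -> L^*] extends [tau].

   Conversely, for [0 -> X^* -> A -> B -> 0] and [0 -> B -> C -> X -> 0],
   injectivity of [L^*] and projectivity of [L] produce [del : B -> K^*] and
   [b : K -> B].  An extension of the form [del b] to [L] makes [del] extend to
   [C -> K^*], because [C] is the pushout of [B <- K -> L]; the pullback of
   [L^* -> K^*] along this extension is the space [E] witnessing nullity. *)

Set Implicit Arguments.
Unset Strict Implicit.
Unset Printing Implicit Defensive.

Import Order.TTheory GRing.Theory Num.Theory.
Import numFieldNormedType.Exports.
Local Open Scope classical_set_scope.
Local Open Scope ring_scope.

(* The library leaves out the pointed joins on products that [cvg] and
   [Uniform_isComplete] need. *)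
HB.saturate prod.

(** * Completeness of products of Banach spaces *)

Section prod_complete.
Context {R : realType} (U V : completeNormedModType R).

Lemma prod_complete (F : set_system (U * V)%type) :
  ProperFilter F -> cauchy F -> cvg F.
Proof.
move=> FF Fc.
have fst_cvg : cvg (fst @ F).
  apply: (@cauchy_cvg_lipschitz _ _ _ _ fst 1 FF Fc) => -[u u'] [v v'].
  by rewrite mul1r prod_normE /= le_max lexx.
have snd_cvg : cvg (snd @ F).
  apply: (@cauchy_cvg_lipschitz _ _ _ _ snd 1 FF Fc) => -[u u'] [v v'].
  by rewrite mul1r prod_normE /= le_max lexx orbT.
apply: (@cauchy_cvg_of _ _ F (lim (fst @ F), lim (snd @ F)) FF Fc) => -[u v] e e0.
move=> uv; rewrite prod_normE ge_max; apply/andP; split.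
- apply: (lim_dist_le FF fst_cvg); apply: filterS uv => -[x y] /=.
  by rewrite prod_normE ge_max => /andP[].
- apply: (lim_dist_le FF snd_cvg); apply: filterS uv => -[x y] /=.
  by rewrite prod_normE ge_max => /andP[].
Qed.

HB.instance Definition _ :=
  Uniform_isComplete.Build (U * V)%type prod_complete.

End prod_complete.

(** * Operators and functionals from bounded linear maps *)

Section operators.
Context {R : realType}.
Implicit Types U V W : normedModType R.

Lemma bounded_cts V W (f : {linear V -> W}) :
  (exists M : R, forall x, `|f x| <= M * `|x|) -> continuous f.
Proof.
move=> [M fM]; apply: bounded_linear_continuous; apply/bounded_funP => r.
exists (`|M| * r) => x xr; apply: (le_trans (fM x)).
by rewrite (le_trans (ler_wpM2r _ (ler_norm M)))// ler_wpM2l.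
Qed.

Definition mkop V W (f : V -> W) (lf : linear f)
    (bf : exists M : R, forall x, `|f x| <= M * `|x|) : operator V W :=
  let g : {linear V -> W} := HB.pack f (GRing.isLinear.Build _ _ _ _ _ lf) in
  HB.pack f (GRing.isLinear.Build _ _ _ _ _ lf)
    (isContinuous.Build V W f (@bounded_cts V W g bf)).

Lemma operator_bounded V W (f : operator V W) :
  exists2 M : R, 0 < M & forall x, `|f x| <= M * `|x|.
Proof.
have /linear_bounded_continuous/linear_boundedP :
  continuous (f : {linear V -> W}) by exact: cts_fun.
by move=> /pinfty_ex_gt0[M M0 fM]; exists M.
Qed.

Lemma mkdual_subproof V (f : V -> R) (lf : linear f)
  (bf : exists M : R, forall x, `|f x| <= M * `|x|) : f \in dual_pred V.
Proof.
by rewrite inE; split => //; exact: (@cts_fun _ _ (@mkop V R f lf bf)).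
Qed.

Definition mkdual V (f : V -> R) (lf : linear f)
    (bf : exists M : R, forall x, `|f x| <= M * `|x|) : dual V :=
  Dual (mkdual_subproof lf bf).

Lemma dual_ext V (f g : dual V) : (forall x, f x = g x) -> f = g.
Proof. by move=> fg; apply: val_inj; exact: funext. Qed.

Lemma comp_op U V W (g : operator V W) (f : operator U V) :
  {h : operator U W | forall x, h x = g (f x)}.
Proof.
have lh : linear (g \o f) by move=> a x y; rewrite /= !linearP.
have bh : exists M : R, forall x, `|(g \o f) x| <= M * `|x|.
  have [M M0 gM] := operator_bounded g; have [N N0 fN] := operator_bounded f.
  exists (M * N) => x; rewrite /= -mulrA (le_trans (gM _))//.
  by rewrite ler_wpM2l// ltW.
by exists (mkop lh bh).
Qed.

End operators.

(** * The open mapping theorem *)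

Section open_mapping.
Context {R : realType} {V W : completeNormedModType R}.
Variable p : operator V W.
Hypothesis p_surj : range p = [set: W].

(** The images of the balls of integer radius cover [W]. By Baire their closures cannot all have
    dense complement, so one of them contains a ball. *)
Lemma open_mapping_baire : exists (n : nat) (w0 : W) (r : {posnum R}),
  ball w0 r%:num `<=` closure (p @` [set v | `|v| <= n%:R]).
Proof.
pose O n := ~` closure (p @` [set v : V | `|v| <= n%:R]).
have O_open n : open (O n) by exact/closed_openC/closed_closure.
have [n nO] : exists n, ~ dense (O n).
  apply: contrapT => /forallNP dO.
  have : dense (\bigcap_n O n).
    by apply: Baire => i; split => //; apply: contrapT => /dO.
  move=> /(_ setT); case=> //; [by exists 0|exact: openT|].
  move=> w [_ Ow]; have [v _ vw] : range p w by rewrite p_surj.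
  have := Ow (Num.truncn `|v|).+1 Logic.I; apply; apply: subset_closure.
  by exists v => //=; rewrite ltW// truncnS_gt.
have [U [[w /open_nbhs_nbhs/nbhs_ballP[r r0 wr]] UO]] := denseNE nO.
exists n, w, (PosNum r0) => x /wr Ux.
by apply: contrapT => nx; have : (U `&` O n) x by []; rewrite UO.
Qed.

(** The ball found by Baire has an unknown centre [w0]. Approximating both [w0 + l *: w] and [w0]
    and subtracting removes the centre. *)
Lemma open_mapping_approx : exists C : R,
  forall w, exists v, `|v| <= C * `|w| /\ `|w - p v| <= `|w| / 2.
Proof.
have [n [w0 [r wr]]] := open_mapping_baire.
exists (4 * n%:R / r%:num) => w.
have [->|w_neq0] := eqVneq w 0.
  by exists 0; rewrite linear0 subr0 !normr0 mulr0 mul0r.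
have w_gt0 : 0 < `|w| by rewrite normr_gt0.
(* This scale gives [l *: w] norm [r / 2], so [w0 + l *: w] stays in the ball. Two errors below
   [r / 8] sum to at most [r / 4], which is half the norm of [l *: w]; the preimage has norm at most
   [2 * n / l], whence the constant [4 * n / r]. *)
pose l := r%:num / (2 * `|w|).
have l0 : 0 < l by rewrite divr_gt0// mulr_gt0.
have lE : l * `|w| = r%:num / 2.
  by rewrite /l; field; rewrite gt_eqF.
have near_img x : ball w0 r%:num x ->
    exists2 v : V, `|v| <= n%:R & `|x - p v| < r%:num / 8.
  move=> /wr /(_ (ball x (r%:num / 8))) []; first by apply: nbhsx_ballx.
  by move=> _ [[v vn <-]]; rewrite -ball_normE /= => ?; exists v.
have [v1 v1n pv1] : exists2 v : V, `|v| <= n%:R & `|w0 + l *: w - p v| < r%:num / 8.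
  apply: near_img; rewrite -ball_normE /= opprD addNKr normrN normrZ gtr0_norm//.
  by rewrite lE ltr_pdivrMr// ltr_pMr// ltr1n.
have [v2 v2n pv2] := near_img _ (ballxx w0 (gt0 r)).
exists (l^-1 *: (v1 - v2)); split.
  rewrite normrZ gtr0_norm ?invr_gt0// mulrC ler_pdivrMr//.
  rewrite (_ : _ * _ * l = n%:R + n%:R).
    by rewrite (le_trans (ler_normB _ _))// lerD.
  by rewrite -mulrA (mulrC _ l) lE; field; rewrite gt_eqF.
rewrite linearZ /= linearB /=.
have -> : w - l^-1 *: (p v1 - p v2) =
    l^-1 *: ((w0 + l *: w - p v1) - (w0 - p v2)).
  have -> : w0 + l *: w - p v1 - (w0 - p v2) = l *: w - (p v1 - p v2).
    by rewrite [w0 + _]addrC -!addrA; congr (_ + _); rewrite !opprB addrA addrC subrKA.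
  by rewrite [RHS]scalerBr scalerA mulVf ?gt_eqF// scale1r.
rewrite normrZ gtr0_norm ?invr_gt0// mulrC ler_pdivrMr//.
rewrite mulrAC (mulrC _ l) lE (le_trans (ler_normB _ _))//.
by rewrite (le_trans (lerD (ltW pv1) (ltW pv2)))//; lra.
Qed.

(** Each approximation halves the residual, so the successive corrections are dominated by a
    geometric series and, [V] being complete, sum to an exact preimage. *)
Lemma open_mapping : exists2 C : R, 0 < C &
  forall w, exists v, p v = w /\ `|v| <= C * `|w|.
Proof.
have [C happ] := open_mapping_approx.
have [h hP] := choice happ.
(* The geometric series of ratio one half contributes the factor 2; adding 1 only makes the constant
   positive. *)
exists (2 * `|C| + 1) => [|w]; first by rewrite ltr_wpDl// mulr_ge0.
(* [x n] is the residual after [n] corrections and [u n] below is the next correction. *)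
pose x n := iter n (fun w => w - p (h w)) w.
have x_le n : `|x n| <= `|w| / 2 ^+ n.
  elim: n => [|n IH]; first by rewrite expr0 divr1.
  rewrite /x iterS -/(x n) (le_trans (hP (x n)).2)//.
  by rewrite exprSr invfM mulrA ler_pM2r.
pose u n := h (x n).
have u_le n : `|u n| <= geometric (`|C| * `|w|) 2^-1 n.
  rewrite (le_trans (hP _).1)// (le_trans (ler_wpM2r _ (ler_norm C)))//=.
  by rewrite -mulrA ler_wpM2l// exprVn.
have half_lt1 : `|2^-1 : R| < 1 by rewrite ger0_norm// invf_lt1// ltr1n.
have u_ncvg : cvgn [normed series u].
  apply: (@series_le_cvg R (fun n => `|u n|) (geometric (`|C| * `|w|) 2^-1)) => //;
    last exact: is_cvg_geometric_series.
  by move=> n /=; rewrite !mulr_ge0// exprn_ge0.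
have u_cvg := normed_cvg u_ncvg.
exists (limn (series u)); split.
  have p_u n : p (series u n) = w - x n.
    elim: n => [|n IH]; first by rewrite /series /= big_geq// linear0 subrr.
    rewrite /series /= big_nat_recr//= linearD /= -/(series u n) IH.
    rewrite opprB -addrA; congr (_ + _).
    by rewrite addrC.
  have x0 : x @ \oo --> (0 : W).
    apply: norm_cvg0; apply: (@squeeze_cvgr _ _ _ _ (cst 0) (geometric `|w| 2^-1)).
    - by apply: nearW => n; rewrite normr_ge0 /= exprVn x_le.
    - exact: cvg_cst.
    - exact: cvg_geometric.
  have pl : (p \o series u) @ \oo --> p (limn (series u)).
    by apply: continuous_cvg => //; exact: cts_fun.
  apply: (@norm_cvg_unique _ _ _ _ _ _ pl).
  rewrite (_ : p \o series u = (fun n => w - x n)); last exact/funext.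
  have := cvgB (@cvg_cst _ w nat \oo _) x0; rewrite subr0; apply.
rewrite (le_trans (lim_series_norm u_ncvg))//.
apply: limr_le => //; apply: nearW => n.
rewrite (@le_trans _ _ (series (geometric (`|C| * `|w|) 2^-1) n))//.
  by apply: ler_sum => i _; exact: u_le.
rewrite (@le_trans _ _ (limn (series (geometric (`|C| * `|w|) 2^-1))))//.
  apply: nondecreasing_cvgn_le; last exact: is_cvg_geometric_series.
  by apply: nondecreasing_series => k _ _ /=; rewrite !mulr_ge0// exprn_ge0.
rewrite (cvg_lim _ (@cvg_geometric_series R (`|C| * `|w|) 2^-1 half_lt1))//.
rewrite [X in _ / X](_ : _ = 2^-1); last by field.
by rewrite invrK mulrDl mul1r mulrC mulrA lerDl.
Qed.

End open_mapping.

(** * The Hahn-Banach theorem *)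

Section hahn_banach.
Context {R : realType} {V : normedModType R}.
Variable N : R.
Hypothesis N_ge0 : 0 <= N.

(* A functional on a subspace is encoded by its graph; the bound at [0] makes
   such a linear graph single-valued. *)
Definition dominated_graph (G : set (V * R)) :=
  [/\ G 0, forall a x y, G x -> G y -> G (a *: x + y) &
      forall x, G x -> x.2 <= N * `|x.1|].

Lemma dominated_graph_extend (G : set (V * R)) (x0 : V) : dominated_graph G ->
  exists G', [/\ dominated_graph G', G `<=` G' & exists c, G' (x0, c)].
Proof.
move=> [G0 Glin Gdom].
have GZ a x : G x -> G (a *: x) by move=> Gx; rewrite -[_ *: _]addr0; exact: Glin.
have GD x y : G x -> G y -> G (x + y).
  by move=> Gx Gy; rewrite -[x]scale1r; exact: Glin.
(* Domination on the enlarged subspace forces the value [c] at [x0] above every element of [L] and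
   below every bound in [Lub]. The triangle inequality makes these requirements compatible, so
   [sup L] serves as [c]. *)
pose L := [set x.2 - N * `|x.1 - x0| | x in G].
have Lub y : G y -> ubound L (N * `|y.1 + x0| - y.2).
  move=> Gy _ [x Gx <-]; rewrite lerBrDr addrAC lerBlDr.
  rewrite (le_trans (Gdom _ (GD _ _ Gx Gy)))// -mulrDr ler_wpM2l//=.
  rewrite (_ : x.1 + y.1 = (y.1 + x0) + (x.1 - x0)) ?ler_normD//.
  by rewrite addrACA subrr addr0 addrC.
have Lsup : has_sup L.
  split; first by exists ((0 : V * R).2 - N * `|(0 : V * R).1 - x0|), 0.
  by exists (N * `|(0 : V * R).1 + x0| - (0 : V * R).2); exact: (Lub 0).
pose c := sup L.
have c_ge x : G x -> x.2 - N * `|x.1 - x0| <= c.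
  by move=> Gx; apply: sup_upper_bound => //; exists x.
have c_le y : G y -> c <= N * `|y.1 + x0| - y.2.
  by move=> Gy; apply: ge_sup; [exact: Lsup.1|exact: Lub].
pose G' := [set z : V * R | exists2 x, G x & exists t, z = x + t *: (x0, c)].
exists G'; split; first split.
- by exists 0 => //; exists 0; rewrite scale0r addr0.
- move=> a _ _ [x Gx [t ->]] [y Gy [s ->]]; exists (a *: x + y); first exact: Glin.
  by exists (a * t + s); rewrite scalerDl -scalerA scalerDr addrACA.
- move=> _ [x Gx [t ->]] /=; rewrite -[t *: c]/(t * c).
  (* Rescaling by the inverse of the absolute value of [t] reduces positive [t] to the upper bounds
     on [c] and negative [t] to the lower ones. *)
  have [t0|t0|->] := ltrgtP t 0; last first.
  + by rewrite scale0r mul0r !addr0; exact: Gdom.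
  + have := c_le _ (GZ t^-1 _ Gx).
    rewrite -(ler_pM2l t0) /= -[_^-1 *: x.2]/(_^-1 * x.2) mulrBr mulVKf ?gt_eqF//.
    rewrite mulrCA -{2}[t]gtr0_norm// -normrZ scalerDr scalerA mulfV ?gt_eqF//.
    by rewrite scale1r; lra.
  + have := c_ge _ (GZ (- t)^-1 _ Gx).
    have nt0 : 0 < - t by rewrite oppr_gt0.
    rewrite -(ler_pM2l nt0) /= -[_^-1 *: x.2]/(_^-1 * x.2) mulrBr mulVKf ?gt_eqF//.
    rewrite mulrCA -{1}[- t]gtr0_norm// -normrZ scalerBr scalerA mulfV ?gt_eqF//.
    by rewrite scale1r scaleNr opprK mulNr; lra.
- by move=> x Gx; exists x => //; exists 0; rewrite scale0r addr0.
- by exists c, 0 => //; exists 1; rewrite scale1r add0r.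
Qed.

Lemma hahn_banach_graph (G : set (V * R)) : dominated_graph G ->
  exists2 g : dual V, (forall x, G x -> g x.1 = x.2) &
    forall v, `|g v| <= N * `|v|.
Proof.
(* Joining [G] to every member makes the empty chain harmless and puts [G] inside the maximal graph
   [A] joined with [G]. *)
move=> Gdom; pose P := [set A | dominated_graph (A `|` G)].
have [|A [PA maxA]] := @Zorn_bigcup _ P.
  move=> F FP Ftot; split.
  - by right; case: Gdom.
  - have [_ Glin _] := Gdom.
    have FlinX X : F X -> forall a x y, (X `|` G) x -> (X `|` G) y ->
        (\bigcup_(X in F) X `|` G) (a *: x + y).
      move=> FX a x y Xx Xy; have [_ Xlin _] := FP _ FX.
      by have [|] := Xlin a _ _ Xx Xy; [left; exists X|right].
    move=> a x y [[X FX Xx]|Gx] [[Y FY Yy]|Gy].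
    + have [XY|YX] := Ftot _ _ FX FY.
        by apply: (FlinX _ FY); left => //; exact: XY.
      by apply: (FlinX _ FX); left => //; exact: YX.
    + by apply: (FlinX _ FX); [left|right].
    + by apply: (FlinX _ FY); [right|left].
    + by right; exact: Glin.
  - move=> x [[X FX Xx]|Gx]; last by have [_ _] := Gdom; exact.
    by have [_ _] := FP _ FX; apply; left.
(* A maximal graph has a value over every [v], since otherwise the one-dimensional extension would
   be strictly larger. *)
have {maxA} A_total v : exists r, (A `|` G) (v, r).
  have [G' [G'dom AG' [c G'c]]] := dominated_graph_extend v PA.
  exists c; left; apply: contrapT => nAc; apply: (maxA G').
    split; last by move/(_ _ G'c).
    by move=> x Ax; apply: AG'; left.
  rewrite /P /= (_ : _ `|` _ = G')//; apply/seteqP; split=> [x [//|Gx]|x]; last by left.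
  by apply: AG'; right.
have [A0 Alin Adom] := PA.
have A_le v r s : (A `|` G) (v, r) -> (A `|` G) (v, s) -> r <= s.
  move=> Ar As; have := Adom _ (Alin (- 1) _ _ As Ar).
  by rewrite /= !scaleN1r addNr normr0 mulr0 addrC subr_le0.
have A_fun v r s : (A `|` G) (v, r) -> (A `|` G) (v, s) -> r = s.
  by move=> Ar As; apply/eqP; rewrite eq_le (A_le _ _ _ Ar As) (A_le _ _ _ As Ar).
have [g gP] := choice A_total.
have g_lin : linear g.
  by move=> a x y; apply: (A_fun _ _ _ (gP _)); exact: (Alin a (x, g x) (y, g y)).
have g_bnd v : `|g v| <= N * `|v|.
  rewrite ler_norml (Adom _ (gP v)) andbT lerNl.
  have := Adom _ (Alin (- 1) _ _ (gP v) A0).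
  by rewrite /= !addr0 !scaleN1r normrN.
exists (mkdual g_lin (ex_intro _ N g_bnd)) => // -[v r] Gvr /=.
by apply: (A_fun v) => //; right.
Qed.

End hahn_banach.

(** An embedding bounded below replaces a subspace: [f] transported to the range of [i] is dominated
    with constant norm of [f] times [M]. The constant is explicit so that a whole family of
    functionals can be extended with a uniform bound. *)
Lemma hahn_banach {R : realType} (V W : normedModType R) (i : operator V W)
    (M : R) (f : dual V) : 0 <= M -> (forall v, `|v| <= M * `|i v|) ->
  exists2 g : dual W, (forall v, g (i v) = f v) &
    forall w, `|g w| <= `|f| * M * `|w|.
Proof.
move=> M0 iM; have N0 : 0 <= `|f| * M by rewrite mulr_ge0.
pose G := [set z : W * R | exists v, z = (i v, f v)].
have [|g gG gN] := @hahn_banach_graph R W (`|f| * M) N0 G; last first.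
  by exists g => // v; apply: (gG (i v, f v)); exists v.
split.
- by exists 0; rewrite !linear0.
- by move=> a _ _ [x ->] [y ->]; exists (a *: x + y); rewrite !linearP.
- move=> _ [v ->] /=; rewrite (le_trans (ler_norm _))//.
  rewrite (le_trans (le_dual_norm _ _))// -mulrA ler_wpM2l// dual_norm_ge0//.
Qed.

(** * The universal property of ell1 *)

Section ell1_basis.
Context {R : realType} {Gamma : choiceType}.
Implicit Types (f : ell1 R Gamma) (A B : {fset Gamma}).

Lemma ell1_sum_le f B : \sum_(i <- B) `|f i| <= `|f|.
Proof.
have := ell1_fsum_le f (finite_fset B).
by rewrite fsbig_finite ?finite_fset// set_fsetK.
Qed.

Lemma ell1_norm_le_sum f (M : R) :
  (forall B, \sum_(i <- B) `|f i| <= M) -> `|f| <= M.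
Proof.
move=> fM; apply: ell1_norm_le => A finA.
by rewrite fsbig_finite//.
Qed.

Lemma ell1_norm_approx f (e : R) : 0 < e ->
  exists B, `|f| - e < \sum_(i <- B) `|f i|.
Proof.
move=> e0; apply: contrapT => /forallNP nB.
have : `|f| <= `|f| - e.
  by apply: ell1_norm_le_sum => B; rewrite leNgt; apply/negP/nB.
by rewrite lerDl oppr_ge0 leNgt e0.
Qed.

Lemma sum_indicator_le1 (i : Gamma) B : \sum_(j <- B) `|(j == i)%:R : R| <= 1.
Proof.
have [iB|iB] := boolP (i \in B).
  rewrite (bigD1_seq i) ?fset_uniq//= eqxx normr1 big1 ?addr0// => j /negPf ->.
  by rewrite normr0.
rewrite big1_seq// => j /andP[_ jB]; case: eqVneq => [ji|]; last by rewrite normr0.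
by rewrite -ji jB in iB.
Qed.

Lemma ell1_delta_subproof (i : Gamma) :
  (fun j => (j == i)%:R : R) \in ell1_pred R Gamma.
Proof.
apply/ell1_predP; exists 1 => A finA; rewrite fsbig_finite//=.
exact: sum_indicator_le1.
Qed.

Definition ell1_delta (i : Gamma) : ell1 R Gamma := Ell1 (ell1_delta_subproof i).

Lemma ell1_delta_norm i : `|ell1_delta i| <= 1.
Proof.
by apply: ell1_norm_le_sum => B; exact: sum_indicator_le1.
Qed.

Section sum_family.
Context {W : normedModType R} (w : Gamma -> W).

Definition ell1_psum f B : W := \sum_(i <- B) f i *: w i.

Lemma ell1_psumP a (f g : ell1 R Gamma) B :
  ell1_psum (a *: f + g) B = a *: ell1_psum f B + ell1_psum g B.
Proof.
rewrite /ell1_psum scaler_sumr -big_split /=; apply: eq_bigr => i _.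
by rewrite scalerA -scalerDl.
Qed.

Lemma ell1_psum_norm f B (M : R) : 0 <= M -> (forall i, `|w i| <= M) ->
  `|ell1_psum f B| <= M * `|f|.
Proof.
move=> M0 wM; rewrite (le_trans (ler_norm_sum _ _ _))//.
rewrite (@le_trans _ _ (\sum_(i <- B) M * `|f i|))//.
  by apply: ler_sum => i _; rewrite normrZ mulrC ler_wpM2r.
by rewrite -mulr_sumr ler_wpM2l// ell1_sum_le.
Qed.

Lemma ell1_psum_delta i B : i \in B -> ell1_psum (ell1_delta i) B = w i.
Proof.
move=> iB; rewrite /ell1_psum (bigD1_seq i) ?fset_uniq//= eqxx scale1r.
by rewrite big1 ?addr0// => j /negPf ->; rewrite scale0r.
Qed.

End sum_family.

Definition ell1_trunc f B : ell1 R Gamma := ell1_psum ell1_delta f B.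

Lemma ell1_truncE f B j : ell1_trunc f B j = if j \in B then f j else 0.
Proof.
have -> : ell1_trunc f B j = \sum_(i <- B) f i * (j == i)%:R.
  by rewrite /ell1_trunc /ell1_psum (big_morph (fun g : ell1 R Gamma => g j)
    (fun f g => ell1D f g j) erefl).
have [jB|jB] := boolP (j \in B).
  rewrite (bigD1_seq j) ?fset_uniq//= eqxx mulr1 big1 ?addr0// => i ij.
  by rewrite eq_sym (negPf ij) mulr0.
rewrite big1_seq// => i /andP[_ iB]; case: eqVneq => [ji|]; last by rewrite mulr0.
by rewrite ji iB in jB.
Qed.

(** Over a finite [A] the error is the mass of [f] on [A] outside [B]. Adding the mass on [B] gives
    the mass on the union, which is at most the norm. *)
Lemma ell1_trunc_norm f B : `|f - ell1_trunc f B| <= `|f| - \sum_(i <- B) `|f i|.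
Proof.
apply: ell1_norm_le_sum => A; rewrite lerBrDr.
rewrite (le_trans _ (ell1_sum_le f (A `|` B)%fset))//.
rewrite [leRHS](bigID (mem B)) /= [leLHS]addrC lerD//.
  rewrite -[leRHS]big_filter.
  rewrite le_eqVlt; apply/orP; left; apply/eqP/perm_big.
  apply: uniq_perm; rewrite ?filter_uniq ?fset_uniq// => i.
  by rewrite mem_filter in_fsetU; case: (i \in B); rewrite ?orbT.
rewrite (eq_bigr (fun i => if i \notin B then `|f i| else 0)); last first.
  move=> i _; transitivity `|f i - ell1_trunc f B i| => //.
  rewrite ell1_truncE; case: (i \in B) => /=.
    by rewrite subrr normr0.
  by rewrite subr0.
rewrite -big_mkcond /= -big_filter -[leRHS]big_filter le_eqVlt.
apply/orP; left; apply/eqP/perm_big.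
apply: uniq_perm; rewrite ?filter_uniq ?fset_uniq// => i.
by rewrite !mem_filter in_fsetU; case: (i \in B); rewrite ?orbF.
Qed.

Lemma ell1_psum_trunc (W : normedModType R) (w : Gamma -> W) f A B :
  (A `<=` B)%fset -> ell1_psum w (ell1_trunc f A) B = ell1_psum w f A.
Proof.
move=> /fsubsetP AB; rewrite /ell1_psum.
rewrite (eq_bigr (fun i => if i \in A then f i *: w i else 0)); last first.
  by move=> i _; rewrite ell1_truncE; case: ifP => // _; rewrite scale0r.
rewrite -big_mkcond -big_filter; apply: perm_big.
apply: uniq_perm; rewrite ?filter_uniq ?fset_uniq// => i.
by rewrite mem_filter; case: (boolP (i \in A)) => // /AB ->.
Qed.

Notation totally := (@summability.totally Gamma).
#[local] Existing Instance summability.totally_filter.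

Lemma ell1_trunc_close f (e : R) : 0 < e ->
  exists A, forall B, (A `<=` B)%fset -> `|f - ell1_trunc f B| <= e.
Proof.
move=> e0; have [A Ae] := ell1_norm_approx f e0.
exists A => B AB; rewrite (le_trans (ell1_trunc_norm f B))//.
suff : \sum_(i <- A) `|f i| <= \sum_(i <- B) `|f i| by lra.
rewrite [leRHS](bigID (mem A)) /= -[leLHS]addr0 lerD ?sumr_ge0//.
rewrite -[leRHS]big_filter le_eqVlt; apply/orP; left; apply/eqP/perm_big.
apply: uniq_perm; rewrite ?filter_uniq ?fset_uniq// => i.
by rewrite mem_filter; case: (boolP (i \in A)) => // /(fsubsetP AB) ->.
Qed.

Lemma ell1_trunc_cvg f : ell1_trunc f B @[B --> totally] --> f.
Proof.
apply/cvgrPdist_le => e e0; have [A fA] := ell1_trunc_close f e0.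
by exists A => // B; exact: fA.
Qed.

(** Truncations are finite combinations of the unit vectors and converge to [f], so the unit vectors
    determine an operator. *)
Lemma ell1_operator_eq (W : normedModType R) (S T : operator (ell1 R Gamma) W) :
  (forall i, S (ell1_delta i) = T (ell1_delta i)) -> forall f, S f = T f.
Proof.
move=> ST f.
have cvgS (U : operator (ell1 R Gamma) W) :
    U (ell1_trunc f B) @[B --> totally] --> U f.
  by apply: continuous_cvg; [exact: cts_fun|exact: ell1_trunc_cvg].
apply: (@norm_cvg_unique _ _ _ _ _ _ (cvgS S)).
rewrite (_ : (fun B => _) = (fun B => T (ell1_trunc f B))); first exact: cvgS.
apply/funext => B; rewrite /ell1_trunc /ell1_psum !linear_sum.
by apply: eq_bigr => i _; rewrite !linearZ /= ST.
Qed.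

(** The operator is the limit of the finite sums of [f i *: w i] along the directed finite subsets
    of [Gamma]; boundedness of [w] makes this net Cauchy. *)
Lemma ell1_operator (W : completeNormedModType R) (w : Gamma -> W) (M : R) :
    0 <= M -> (forall i, `|w i| <= M) ->
  exists S : operator (ell1 R Gamma) W, forall i, S (ell1_delta i) = w i.
Proof.
move=> M0 wM.
have psum_cvg f : cvg (ell1_psum w f B @[B --> totally]).
  apply/cauchy_cvgP/cauchy_exP => e e0.
  have Me0 : 0 < e / (M + 1) by rewrite divr_gt0// ltr_wpDl.
  have [A fA] := ell1_trunc_close f Me0.
  exists (ell1_psum w f A); exists A => // B AB /=; rewrite -ball_normE /=.
  (* Writing the sum over [A] as a sum over [B] of the truncation turns the difference into one
     partial sum of a vector of small norm. *)
  rewrite -(ell1_psum_trunc w f AB).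
  have -> : ell1_psum w (ell1_trunc f A) B - ell1_psum w f B =
      ell1_psum w (ell1_trunc f A - f) B.
    rewrite (_ : ell1_trunc f A - f = (- 1) *: f + ell1_trunc f A).
      by rewrite ell1_psumP scaleN1r addrC.
    by rewrite scaleN1r addrC.
  rewrite (le_lt_trans (ell1_psum_norm _ _ M0 wM))// distrC.
  rewrite (le_lt_trans (ler_wpM2l M0 (fA A _)))//.
  by rewrite mulrA ltr_pdivrMr ?ltr_wpDl// mulrC ltr_pM2l// ltrDl.
pose S f : W := lim (ell1_psum w f B @[B --> totally]).
have S_lin : linear S.
  move=> a f g; apply: (@norm_cvg_unique _ _ _ _ _ _ (psum_cvg _)).
  rewrite (_ : (fun B => _) = (fun B => a *: ell1_psum w f B + ell1_psum w g B)).
    by apply: cvgD; [apply: cvgZr|]; exact: psum_cvg.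
  by apply/funext => B; rewrite ell1_psumP.
have S_bnd : exists M : R, forall f, `|S f| <= M * `|f|.
  exists M => f; rewrite -normrN -sub0r.
  apply: (lim_dist_le _ (psum_cvg f)).
  by exists fset0 => // B _ /=; rewrite sub0r normrN ell1_psum_norm.
exists (mkop S_lin S_bnd) => i /=.
apply: (@norm_cvg_unique _ _ _ _ _ _ (psum_cvg _)).
apply/cvgrPdist_le => e e0; exists [fset i]%fset => // B /=.
by rewrite fsub1set => iB; rewrite ell1_psum_delta// subrr normr0 ltW.
Qed.

End ell1_basis.

(** * Factorization, lifting and extension of operators *)

Section banach.
Context {R : realType}.
Implicit Types V W Z : completeNormedModType R.

Lemma opkerP (V W : normedModType R) (f : operator V W) (x : opker f) :
  f (\val x) = 0.
Proof. by have := opker_valP x; rewrite inE => /eqP. Qed.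

Lemma opker_ex (V W : normedModType R) (f : operator V W) (v : V) :
  f v = 0 -> exists x : opker f, \val x = v.
Proof.
move=> fv0; have vker : v \in opker_pred f by rewrite inE fv0.
by exists (Opker vker).
Qed.

Lemma opker_corestrict (U V W : normedModType R) (f : operator V W)
    (g : operator U V) : (forall u, f (g u) = 0) ->
  exists h : operator U (opker f), forall u, \val (h u) = g u.
Proof.
move=> fg0; have [h hg] := choice (fun u => opker_ex (fg0 u)).
have h_lin : linear h.
  by move=> a x y; apply: val_inj; rewrite hg !linearP /= !hg.
have h_bnd : exists M : R, forall u, `|h u| <= M * `|u|.
  have [M _ gM] := operator_bounded g.
  by exists M => u; rewrite opker_normE hg.
by exists (mkop h_lin h_bnd).
Qed.

Lemma opker_incl (V W : normedModType R) (f : operator V W) :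
  exists j : operator (opker f) V, forall x, j x = \val x.
Proof.
have j_lin : linear (val : opker f -> V) by move=> a x y; rewrite linearP.
have j_bnd : exists M : R, forall x : opker f, `|val x| <= M * `|x|.
  by exists 1 => x; rewrite mul1r.
by exists (mkop j_lin j_bnd).
Qed.

(** The open mapping theorem supplies a bounded right inverse [s] of [p], possibly nonlinear. The
    composite [f \o s] is nevertheless linear, because [f v] depends only on [p v]. *)
Lemma operator_factor V W Z (p : operator V W) (f : operator V Z) :
    range p = [set: W] -> (forall v, p v = 0 -> f v = 0) ->
  exists g : operator W Z, forall v, g (p v) = f v.
Proof.
move=> p_surj f0; have [C C0 pC] := open_mapping p_surj.
have fE u v : p u = p v -> f u = f v.
  move=> puv; apply/eqP; rewrite -subr_eq0 -linearB; apply/eqP/f0.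
  by rewrite linearB /= puv subrr.
have [s sp] := choice pC.
have g_lin : linear (f \o s).
  move=> a x y; rewrite /= -[RHS]linearP; apply: fE.
  by rewrite linearP /= !(fun w => (sp w).1).
have g_bnd : exists M : R, forall w, `|(f \o s) w| <= M * `|w|.
  have [M M0 fM] := operator_bounded f.
  exists (M * C) => w; rewrite /= (le_trans (fM _))// -mulrA.
  by rewrite ler_wpM2l ?(ltW M0)// (sp w).2.
by exists (mkop g_lin g_bnd) => v /=; apply: fE; rewrite (sp _).1.
Qed.

(** Exactness makes [i] a bijection onto the Banach space [opker q], so the open mapping theorem
    bounds its inverse. *)
Lemma exact_bounded_below V W Z (i : operator V W) (q : operator W Z) :
    (forall v, i v = 0 -> v = 0) -> range i = q @^-1` [set 0] ->
  exists2 M : R, 0 < M & forall v, `|v| <= M * `|i v|.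
Proof.
move=> i_inj iq.
have qi v : q (i v) = 0 by have : (q @^-1` [set 0]) (i v) by rewrite -iq; exists v.
have [h hi] := opker_corestrict qi.
have h_surj : range h = [set: opker q].
  apply/seteqP; split=> // x _.
  have : range i (\val x) by rewrite iq /=; exact: opkerP.
  by move=> [v _ vx]; exists v => //; apply: val_inj; rewrite hi.
have [M M0 hM] := open_mapping h_surj.
exists M => // v; have [u [huv uM]] := hM (h v).
suff uv : u = v by move: uM; rewrite uv opker_normE hi.
apply/eqP; rewrite -subr_eq0; apply/eqP/i_inj.
have iuv : i u = i v by rewrite -!hi; exact: (congr1 val huv).
by rewrite linearB /= iuv subrr.
Qed.

Lemma operator_corestrict (U V W : normedModType R) (i : operator V W)
    (f : operator U W) (M : R) : 0 <= M -> (forall v, `|v| <= M * `|i v|) ->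
    (forall u, exists v, i v = f u) ->
  exists g : operator U V, forall u, i (g u) = f u.
Proof.
move=> M0 iM if_; have [g gP] := choice if_.
have i_inj u v : i u = i v -> u = v.
  move=> uv; apply/eqP; rewrite -subr_eq0 -normr_le0 (le_trans (iM _))//.
  by rewrite linearB /= uv subrr normr0 mulr0.
have g_lin : linear g by move=> a x y; apply: i_inj; rewrite gP !linearP /= !gP.
have g_bnd : exists M : R, forall u, `|g u| <= M * `|u|.
  have [N N0 fN] := operator_bounded f.
  exists (M * N) => u; rewrite (le_trans (iM _))// gP -mulrA.
  by rewrite ler_wpM2l.
by exists (mkop g_lin g_bnd).
Qed.

Lemma short_exactP V W Z (i : operator V W) (q : operator W Z) :
  short_exact i q <->
  [/\ forall v, i v = 0 -> v = 0, forall v, q (i v) = 0,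
      forall w, q w = 0 -> exists v, i v = w & forall z, exists w, q w = z].
Proof.
split=> [[i0 iq qT]|[i0 qi iq qT]]; split.
- move=> v iv0; have : (i @^-1` [set 0]) v by [].
  by rewrite i0.
- by move=> v; have : (q @^-1` [set 0]) (i v) by rewrite -iq; exists v.
- by move=> w qw0; have [v _ vw] : range i w; [rewrite iq|exists v].
- by move=> z; have [w _ wz] : range q z; [rewrite qT|exists w].
- by apply/seteqP; split=> v /= => [/i0//|->]; rewrite linear0.
- apply/seteqP; split=> [_ [v _ <-]|w /iq[v <-]] /=; first exact: qi.
  by exists v.
- by apply/seteqP; split=> // z _; have [w wz] := qT z; exists w.
Qed.

(** Projectivity of ell1: the images of the unit vectors are lifted one by one, with a uniform bound
    from the open mapping theorem. *)
Lemma ell1_lift (Gamma : choiceType) V W (p : operator V W)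
    (f : operator (ell1 R Gamma) W) : range p = [set: W] ->
  exists g : operator (ell1 R Gamma) V, forall l, p (g l) = f l.
Proof.
move=> p_surj; have [C C0 pC] := open_mapping p_surj.
have [w wP] := choice (fun i => pC (f (ell1_delta i))).
have [M M0 fM] := operator_bounded f.
have wM i : `|w i| <= C * M.
  rewrite (le_trans (wP i).2)// ler_wpM2l ?(ltW C0)// (le_trans (fM _))//.
  by rewrite ler_piMr ?(ltW M0)// ell1_delta_norm.
have [g gw] := ell1_operator (ltW (mulr_gt0 C0 M0)) wM.
have [pg pgE] := comp_op p g.
exists g => l; rewrite -pgE; apply: ell1_operator_eq => i.
by rewrite pgE gw (wP i).1.
Qed.

Lemma dual_bilinear (U V : normedModType R) (b : U -> V -> R) (M : R) :
    (forall v, linear (b ^~ v)) -> (forall u, linear (b u)) ->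
    (forall u v, `|b u v| <= M * `|u| * `|v|) ->
  exists T : operator U (dual V), forall u v, T u v = b u v.
Proof.
move=> b_linl b_linr bM.
have b_bnd u : exists N : R, forall v, `|b u v| <= N * `|v|.
  by exists (M * `|u|).
pose T u := mkdual (b_linr u) (b_bnd u).
have T_lin : linear T by move=> a x y; apply: dual_ext => v /=; exact: b_linl.
have T_bnd : exists N : R, forall u, `|T u| <= N * `|u|.
  exists `|M| => u; apply: dual_norm_le => v v1 /=.
  rewrite (le_trans (bM _ _))// (@le_trans _ _ (`|M| * `|u| * `|v|))//.
    by rewrite !ler_wpM2r// ler_norm.
  by rewrite ler_piMr// mulr_ge0.
by exists (mkop T_lin T_bnd).
Qed.

Lemma dual_operator_bounded (U V : normedModType R) (T : operator U (dual V)) :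
  exists2 M : R, 0 < M & forall u v, `|T u v| <= M * `|u| * `|v|.
Proof.
have [M M0 TM] := operator_bounded T.
exists M => // u v; rewrite (le_trans (le_dual_norm _ _))//.
by rewrite ler_wpM2r// -dual_normE.
Qed.

Lemma dual_transpose (U V : normedModType R) (T : operator U (dual V)) :
  exists S : operator V (dual U), forall v u, S v u = T u v.
Proof.
have [M M0 TM] := dual_operator_bounded T.
apply: (@dual_bilinear V U (fun v u => T u v) M) => [u a x y|v a x y|v u] /=.
- by rewrite linearP.
- by rewrite linearP.
- by rewrite mulrAC.
Qed.

Lemma dual_precomp (U V : normedModType R) (f : operator U V) :
  exists f' : operator (dual V) (dual U), forall phi u, f' phi u = phi (f u).
Proof.
have [M M0 fM] := operator_bounded f.
apply: (@dual_bilinear (dual V) U (fun phi u => phi (f u)) M).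
- by move=> u a x y.
- by move=> phi a x y; rewrite !linearP.
- move=> phi u; rewrite (le_trans (le_dual_norm _ _))// -mulrA mulrCA.
  by rewrite ler_wpM2l// dual_norm_ge0.
Qed.

(** Transposed, [f] is a bounded family of functionals on [V] indexed by [Gamma]. Each is extended
    to [W] by Hahn-Banach with the same constant, and the extended family is reassembled and
    transposed back. *)
Lemma dual_ell1_injective (Gamma : choiceType) (V W : normedModType R)
    (i : operator V W) (M : R) (f : operator V (dual (ell1 R Gamma))) :
    0 <= M -> (forall v, `|v| <= M * `|i v|) ->
  exists g : operator W (dual (ell1 R Gamma)), forall v, g (i v) = f v.
Proof.
move=> M0 iM; have [ft ftE] := dual_transpose f.
have [N N0 ftN] := operator_bounded ft.
have [w wP] := choice (fun j => let: ex_intro2 g gi gN :=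
    hahn_banach (ft (ell1_delta j)) M0 iM in
  ex_intro (fun g : dual W => (forall v, g (i v) = ft (ell1_delta j) v) /\
    forall x, `|g x| <= `|ft (ell1_delta j)| * M * `|x|) g (conj gi gN)).
have w_bnd j : `|w j| <= N * M.
  apply: dual_norm_le => x x1; rewrite (le_trans ((wP j).2 x))//.
  rewrite (@le_trans _ _ (`|ft (ell1_delta j)| * M))//.
    by rewrite ler_piMr// mulr_ge0.
  rewrite ler_wpM2r// (le_trans (ftN _))// ler_piMr ?(ltW N0)//.
  exact: ell1_delta_norm.
have [S SE] := ell1_operator (mulr_ge0 (ltW N0) M0) w_bnd.
have [g gE] := dual_transpose S.
have [i' i'E] := dual_precomp i.
have [Si SiE] := comp_op i' S.
exists g => v; apply: dual_ext => l; rewrite gE -ftE -i'E -SiE.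
rewrite (@ell1_operator_eq _ _ _ Si ft)// => j; apply: dual_ext => u.
by rewrite SiE i'E SE (wP j).1.
Qed.

Lemma bilinear_of_operator (U V : normedModType R) (T : operator U (dual V)) :
  exists B : {bilinear U -> V -> R},
    continuous (fun p : U * V => B p.1 p.2) /\ forall u v, B u v = T u v.
Proof.
have T_bilin : bilinear_for *:%R *:%R (fun u v => T u v).
  by split=> [v a x y|u a x y]; rewrite linearP.
pose B : {bilinear U -> V -> R} :=
  HB.pack (fun u v => T u v) (bilinear_isBilinear.Build R U V R _ _ _ T_bilin).
exists B; split => // -[u v] /=.
have [M M0 TM] := dual_operator_bounded T.
apply/cvgrPdist_le => e e0 /=.
(* The bound 1 keeps the norm of [p.2] below that of [v] plus 1; the other bound makes the two terms
   of the split difference sum to at most [e]. *)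
pose d := Num.min 1 (e / (M * (`|u| + `|v| + 1))).
have K0 : 0 < M * (`|u| + `|v| + 1) by rewrite mulr_gt0// ltr_wpDl// addr_ge0.
have d0 : 0 < d by rewrite lt_min ltr01 divr_gt0.
near=> p.
have pd : `|(u, v) - p| <= d by near: p; apply: cvgr_dist_le.
have [up vp] : `|u - p.1| <= d /\ `|v - p.2| <= d.
  by move: pd; rewrite prod_normE ge_max => /andP[].
have p2 : `|p.2| <= `|v| + 1.
  rewrite -[p.2](subKr v) (le_trans (ler_normB _ _))// lerD2l.
  by rewrite (le_trans vp)// ge_min lexx.
have -> : T u v - T p.1 p.2 = T (u - p.1) p.2 + T u (v - p.2).
  have -> : T (u - p.1) p.2 = T u p.2 - T p.1 p.2 by rewrite linearB.
  by rewrite linearB /=; ring.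
rewrite (le_trans (ler_normD _ _))//.
rewrite (@le_trans _ _ (M * d * (`|v| + 1) + M * `|u| * d))//.
  rewrite lerD//.
    by rewrite (le_trans (TM _ _))// ler_pM// ?mulr_ge0 ?ler_wpM2l// ltW.
  by rewrite (le_trans (TM _ _))// ler_wpM2l// mulr_ge0// ltW.
rewrite (_ : _ + _ = d * (M * (`|u| + `|v| + 1))); last by ring.
by rewrite -ler_pdivlMr// ge_min lexx orbT.
Unshelve. all: by end_near. Qed.

End banach.

(** * Ext2 and bilinear forms *)

(** This is exactness of the dual sequence at [dual V]. *)
Lemma dual_kernel_factor {R : realType} (V W : completeNormedModType R)
    (Q : operator V W) (phi : dual V) : range Q = [set: W] ->
  (forall k : opker Q, phi (\val k) = 0) ->
  exists f : dual W, forall v, f (Q v) = phi v.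
Proof.
move=> hQ phi0.
have bphi : exists M : R, forall v, `|phi v| <= M * `|v|.
  by exists `|phi| => v; exact: le_dual_norm.
have [|g gE] := @operator_factor R V W R Q (mkop (dual_linear phi) bphi) hQ.
  by move=> v /opker_ex[k <-]; exact: phi0.
have bg : exists M : R, forall w, `|g w| <= M * `|w|.
  by have [M _ gM] := operator_bounded g; exists M.
have lg : linear g by move=> a x y; rewrite linearP.
by exists (mkdual lg bg) => v /=; rewrite gE.
Qed.

(** * The dual of the kernel sequence of a quotient map and its pullbacks *)

Section pullback.
Context {R : realType} {L X : completeNormedModType R}.
Variable Q : operator L X.
Hypothesis Q_surj : range Q = [set: X].

Lemma opker_incl_exact (j : operator (opker Q) L) :
  (forall k, j k = \val k) -> short_exact j Q.
Proof.
move=> jE; apply/short_exactP; split.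
- by move=> k; rewrite jE => k0; exact: val_inj.
- by move=> k; rewrite jE opkerP.
- by move=> l /opker_ex[k kl]; exists k; rewrite jE.
- by move=> x; have [l _ lx] : range Q x; [rewrite Q_surj|exists l].
Qed.

Lemma dual_opker_extend (psi : dual (opker Q)) :
  exists phi : dual L, forall k : opker Q, phi (\val k) = psi k.
Proof.
have [j jE] := opker_incl Q.
have [|g gE _] := hahn_banach (i := j) (M := 1) psi ler01.
  by move=> k; rewrite mul1r jE.
by exists g => k; rewrite -gE jE.
Qed.

(* The pullback of [0 -> dual X -> dual L -> dual (opker Q) -> 0] along [gam]. *)
Lemma dual_pullback (C : completeNormedModType R) (gam : operator C (dual (opker Q))) :
  exists (E : completeNormedModType R) (u : operator (dual X) E)
      (r : operator E C) (pr : operator E (dual L)),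
    [/\ short_exact u r,
        forall f l, pr (u f) l = f (Q l),
        forall e (k : opker Q), pr e (\val k) = gam (r e) k &
        forall (V : completeNormedModType R) (f : operator V C)
          (g : operator V (dual L)),
          (forall v (k : opker Q), g v (\val k) = gam (f v) k) ->
          exists h : operator V E, (forall v, r (h v) = f v) /\
            forall v, pr (h v) = g v].
Proof.
have [j jE] := opker_incl Q.
have [j' j'E] := dual_precomp j.
have [Q' Q'E] := dual_precomp Q.
(* The pullback is realized as the kernel of this difference operator on the product, hence is a
   Banach space. *)
pose D0 (p : C * dual L) := gam p.1 - j' p.2.
have D0_lin : linear D0.
  by move=> a x y; rewrite /D0 /= !linearP /= [in RHS]scalerDr addrACA.
have D0_bnd : exists M : R, forall p, `|D0 p| <= M * `|p|.
  have [M M0 gM] := operator_bounded gam; have [N N0 jN] := operator_bounded j'.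
  exists (M + N) => p; rewrite (le_trans (ler_normB _ _))// mulrDl.
  rewrite prod_normE lerD// ?(le_trans (gM _))// ?(le_trans (jN _))//.
    by rewrite ler_wpM2l ?(ltW M0)// le_max lexx.
  by rewrite ler_wpM2l ?(ltW N0)// le_max lexx orbT.
pose D := mkop D0_lin D0_bnd.
have DP (p : C * dual L) : D p = 0 <-> forall k : opker Q, p.2 (\val k) = gam p.1 k.
  split=> [Dp0 k|pk].
    have : gam p.1 - j' p.2 = 0 := Dp0.
    by move/eqP; rewrite subr_eq0 => /eqP ->; rewrite j'E jE.
  apply/eqP; rewrite subr_eq0; apply/eqP/dual_ext => k.
  by rewrite j'E jE pk.
have r_lin : linear (fun e : opker D => (\val e).1).
  by move=> a x y; rewrite linearP.
have r_bnd : exists M : R, forall e : opker D, `|(\val e).1| <= M * `|e|.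
  by exists 1 => e; rewrite mul1r opker_normE prod_normE le_max lexx.
have pr_lin : linear (fun e : opker D => (\val e).2).
  by move=> a x y; rewrite linearP.
have pr_bnd : exists M : R, forall e : opker D, `|(\val e).2| <= M * `|e|.
  by exists 1 => e; rewrite mul1r opker_normE prod_normE le_max lexx orbT.
pose r := mkop r_lin r_bnd; pose pr := mkop pr_lin pr_bnd.
have prr e (k : opker Q) : pr e (\val k) = gam (r e) k.
  by have /DP := opkerP e; apply.
have lift (V : completeNormedModType R) (f : operator V C) (g : operator V (dual L)) :
    (forall v (k : opker Q), g v (\val k) = gam (f v) k) ->
    exists h : operator V (opker D), (forall v, r (h v) = f v) /\
      forall v, pr (h v) = g v.
  move=> fg; have fg_lin : linear (fun v => (f v, g v)).
    by move=> a x y; rewrite !linearP.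
  have fg_bnd : exists M : R, forall v, `|(f v, g v)| <= M * `|v|.
    have [M M0 fM] := operator_bounded f; have [N N0 gN] := operator_bounded g.
    exists (M + N) => v; rewrite prod_normE ge_max /= (le_trans (fM v))//=.
      by rewrite (le_trans (gN v))// ler_wpM2r// lerDr ltW.
    by rewrite ler_wpM2r// lerDl ltW.
  have [h hE] := @opker_corestrict R V _ _ D (mkop fg_lin fg_bnd)
    (fun v => (DP (f v, g v)).2 (fg v)).
  by exists h; split=> v; rewrite /= hE.
have z_lin : linear (fun _ : dual X => 0 : C).
  by move=> a x y; rewrite scaler0 addr0.
have z_bnd : exists M : R, forall f : dual X, `|0 : C| <= M * `|f|.
  by exists 0 => f; rewrite normr0 mul0r.
(* [u] is induced by the pair of the zero map and [Q'], compatible because [Q] vanishes on its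
   kernel. *)
have [|u [ru pru]] := lift (dual X) (mkop z_lin z_bnd) Q'.
  by move=> f k; rewrite Q'E opkerP /= !linear0.
have prQ f l : pr (u f) l = f (Q l) by rewrite pru Q'E.
exists (opker D : completeNormedModType R), u, r, pr; split=> //.
apply/short_exactP; split.
- move=> f uf0; apply: dual_ext => x.
  have [l _ <-] : range Q x by rewrite Q_surj.
  by rewrite -prQ uf0 linear0.
- by move=> f; rewrite ru.
- move=> e re0.
  have [k|f fE] := @dual_kernel_factor R L X Q (pr e) Q_surj.
    by rewrite prr re0 linear0.
  have valE (z : opker D) : \val z = (r z, pr z) by exact: surjective_pairing.
  exists f; apply: val_inj; rewrite !valE ru re0; congr pair.
  by apply: dual_ext => l; rewrite -fE prQ.
(* Surjectivity of [r] comes from Hahn-Banach extension of [gam x]. *)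
- move=> x; have [phi phiE] := dual_opker_extend (gam x).
  have [e ep] := opker_ex ((DP (x, phi)).2 phiE).
  by exists e; rewrite /r /= ep.
Qed.

End pullback.

(** * Nullity of concatenations and extension of forms *)

Section ext2_bilinear.
Context {R : realType} {X : completeNormedModType R} {Gamma : choiceType}.
Variable Q : operator (ell1 R Gamma) X.
Hypothesis Q_surj : range Q = [set: X].

Lemma ext2_eq0_extend : Ext2_eq0 X (dual X) ->
  forall tau : operator (opker Q) (dual (opker Q)),
  exists T : operator (ell1 R Gamma) (dual (ell1 R Gamma)),
    forall x y : opker Q, T (\val x) (\val y) = tau x y.
Proof.
move=> /Ext2_eq0P ext0 tau.
have [A [i1 [q1 [pr [F_exact prQ prtau _]]]]] := dual_pullback Q_surj tau.
have [j jE] := opker_incl Q.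
have G_exact := opker_incl_exact Q_surj jE.
have [E [u [r [v [s [ur_exact vs_exact viu rv sr]]]]]] :=
  ext0 (Concat (Ses F_exact) (Ses G_exact)).
move: u r v s ur_exact vs_exact viu rv sr => /= u r v s ur_exact vs_exact viu rv sr.
have [_ vs _] := vs_exact.
have [v_inj sv s_ker _] := (short_exactP v s).1 vs_exact.
have [M M0 vM] := exact_bounded_below v_inj vs.
have [w wE] := dual_ell1_injective pr (ltW M0) vM.
have [id_l id_b] : linear (@id (ell1 R Gamma)) /\
    exists M : R, forall l : ell1 R Gamma, `|id l| <= M * `|l|.
  by split=> //; exists 1 => l; rewrite mul1r.
have r_surj : range r = [set: ell1 R Gamma] by case: ur_exact.
have [sig sigE] := ell1_lift (mkop id_l id_b) r_surj.
have [T TE] := comp_op w sig.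
exists T => x y.
(* On the kernel of [Q] the section [sig] takes values in the kernel of [s], that is, in the range
   of [v]. There [w] is [pr], which restricts to [tau (q1 a)], and the commuting square gives
   [q1 a = x]. *)
have [|a av] := s_ker (sig (\val x)).
  by rewrite -sr /= sigE /= opkerP.
have q1a : q1 a = x.
  apply: val_inj; rewrite -jE.
  have := congr1 (fun f => f a) rv; rewrite /= => <-.
  by rewrite av sigE.
by rewrite TE -av wE prtau q1a.
Qed.

Lemma extend_ext2_eq0 :
    (forall tau : operator (opker Q) (dual (opker Q)),
      exists T : operator (ell1 R Gamma) (dual (ell1 R Gamma)),
        forall x y : opker Q, T (\val x) (\val y) = tau x y) ->
  Ext2_eq0 X (dual X).
Proof.
move=> ext; apply/Ext2_eq0P => -[B [A i1 q1 F_exact] [C i2 q2 G_exact]].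
rewrite /concat_null /=.
have [i1_inj q1i1 q1_ker q1_onto] := (short_exactP i1 q1).1 F_exact.
have [i2_inj q2i2 q2_ker q2_onto] := (short_exactP i2 q2).1 G_exact.
have [_ iq1 q1_surj] := F_exact; have [_ iq2 q2_surj] := G_exact.
have [j jE] := opker_incl Q.
have [j' j'E] := dual_precomp j.
have [Q' Q'E] := dual_precomp Q.
have [M1 M10 i1M] := exact_bounded_below i1_inj iq1.
have [M2 M20 i2M] := exact_bounded_below i2_inj iq2.
(* [alp] extends [Q'] from [dual X] to [A]. Restricted to the kernel of [Q], it kills the range of
   [i1] and so descends to [del] on [B]. *)
have [alp alpE] := dual_ell1_injective Q' (ltW M10) i1M.
have [ja jaE] := comp_op j' alp.
have [a|del delE] := operator_factor q1_surj (f := ja).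
  move=> /q1_ker[f <-]; apply: dual_ext => k.
  by rewrite jaE j'E alpE Q'E jE opkerP linear0.
(* [c] lifts [Q] through [q2], hence sends the kernel of [Q] into the range of [i2], which defines
   [b]. *)
have [c cE] := ell1_lift Q q2_surj.
have [cj cjE] := comp_op c j.
have [k|b bE] := operator_corestrict (f := cj) (ltW M20) i2M.
  by apply: q2_ker; rewrite cjE cE jE opkerP.
have [tau tauE] := comp_op del b.
have [T TE] := ext tau.
have [jT jTE] := comp_op j' T.
(* [p0] presents [C] as a quotient of [B * ell1 R Gamma] whose kernel consists of the pairs of
   [- b k] and [k]. On these [g0] vanishes because [T] extends [tau], the composite of [del] and
   [b], so [g0] descends to [gam]. *)
pose p0 (z : B * ell1 R Gamma) := i2 z.1 + c z.2.
pose g0 (z : B * ell1 R Gamma) := del z.1 + jT z.2.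
have p0_lin : linear p0.
  by move=> a x y; rewrite /p0 /= !linearP /= scalerDr addrACA.
have g0_lin : linear g0.
  by move=> a x y; rewrite /g0 /= !linearP /= scalerDr addrACA.
have sum_bnd (W : normedModType R) (f : operator B W) (g : operator (ell1 R Gamma) W) :
    exists M : R, forall z : B * ell1 R Gamma, `|f z.1 + g z.2| <= M * `|z|.
  have [M M0 fM] := operator_bounded f; have [N N0 gN] := operator_bounded g.
  exists (M + N) => z; rewrite (le_trans (ler_normD _ _))// mulrDl prod_normE.
  rewrite lerD// ?(le_trans (fM _))// ?(le_trans (gN _))//.
    by rewrite ler_wpM2l ?(ltW M0)// le_max lexx.
  by rewrite ler_wpM2l ?(ltW N0)// le_max lexx orbT.
pose p := mkop p0_lin (sum_bnd _ i2 c); pose g := mkop g0_lin (sum_bnd _ del jT).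
have p_surj : range p = [set: C].
  apply/seteqP; split=> // x _.
  have [l _ lx] : range Q (q2 x) by rewrite Q_surj.
  have [|b' b'E] := q2_ker (x - c l); first by rewrite linearB /= cE lx subrr.
  by exists (b', l) => //=; rewrite /p0 /= b'E subrK.
have [gam gamE] : exists gam : operator C (dual (opker Q)), forall z, gam (p z) = g z.
  apply: operator_factor => // -[b' l] /= ; rewrite /p0 /g0 /= => bl0.
  have Ql : Q l = 0 by rewrite -cE -[RHS](linear0 q2) -bl0 linearD /= q2i2 add0r.
  have [k kl] := opker_ex Ql.
  have -> : b' = - b k.
    apply/eqP; rewrite -subr_eq0 opprK; apply/eqP/i2_inj.
    by rewrite linearD /= bE cjE jE kl.
  apply: dual_ext => k'; rewrite linearN /=.
  rewrite -[LHS]/(- (del (b k) k') + jT l k') jTE j'E jE -kl TE tauE addNr//.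
have gam_i2 b' : gam (i2 b') = del b'.
  by have := gamE (b', 0); rewrite /= /p0 /g0 /= !linear0 !addr0.
have [E [u [r [pr [ur_exact prQ prgam lift]]]]] := dual_pullback Q_surj gam.
have [i2q1 i2q1E] := comp_op i2 q1.
(* The pair [i2q1], [alp] is compatible since [gam] extends [del], so it induces [v] into the
   pullback. *)
have [|v [rv prv]] := lift A i2q1 alp.
  by move=> a k; rewrite i2q1E gam_i2 delE jaE j'E jE.
have [s sE] := comp_op q2 r.
have [u_inj ru r_ker r_onto] := (short_exactP u r).1 ur_exact.
(* The maps [r] and [pr] jointly separate points of [E]: on the kernel of [r], which is the range of
   [u], [pr] is precomposition with the surjection [Q]. *)
have E_inj e : r e = 0 -> pr e = 0 -> e = 0.
  move=> /r_ker[f <-] prf0; rewrite [f](_ : _ = 0) ?linear0//.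
  apply: dual_ext => x; have [l _ <-] : range Q x by rewrite Q_surj.
  by rewrite -prQ prf0.
have E_eq e e' : r e = r e' -> pr e = pr e' -> e = e'.
  move=> re pre; apply/eqP; rewrite -subr_eq0; apply/eqP/E_inj.
    by rewrite linearB /= re subrr.
  by rewrite linearB /= pre subrr.
have vi1 f : v (i1 f) = u f.
  apply: E_eq; first by rewrite rv i2q1E q1i1 linear0 ru.
  by rewrite prv alpE; apply: dual_ext => l; rewrite Q'E prQ.
exists E, u, r, v, s; split.
- exact: ur_exact.
- apply/short_exactP; split.
  + move=> a va0; have : i2 (q1 a) = 0 by rewrite -i2q1E -rv va0 linear0.
    move=> /i2_inj/q1_ker[f fa]; rewrite -fa; rewrite -fa vi1 in va0.
    by rewrite (u_inj _ va0) linear0.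
  + by move=> a; rewrite sE rv i2q1E q2i2.
  + move=> e; rewrite sE => /q2_ker[b' b'E].
    have [a ab] := q1_onto b'.
    (* [e] and [v a] agree under [r], so they differ by some [u f]; since [u f = v (i1 f)],
       correcting [a] by [i1 f] gives the preimage. *)
    have [|f fE] := r_ker (e - v a).
      by rewrite linearB /= rv i2q1E ab b'E subrr.
    by exists (a + i1 f); rewrite linearD /= vi1 fE addrC subrK.
  + by move=> x; have [y <-] := q2_onto x; have [e <-] := r_onto y; exists e.
- by apply/funext => f /=.
- by apply/funext => a /=; rewrite rv i2q1E.
- by apply/funext => e /=; rewrite sE.
Qed.

End ext2_bilinear.

Theorem theorem1p1 (R : realType) (X : completeNormedModType R)
    (Gamma : choiceType) (Q : operator (ell1 R Gamma) X)
    (hQ : range Q = [set: X]) :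
  Ext2_eq0 X (dual X) <->
  (forall b : {bilinear opker Q -> opker Q -> R},
     continuous (fun p : opker Q * opker Q => b p.1 p.2) ->
     exists B : {bilinear ell1 R Gamma -> ell1 R Gamma -> R},
       continuous (fun p : ell1 R Gamma * ell1 R Gamma => B p.1 p.2) /\
       (forall x y : opker Q, B (\val x) (\val y) = b x y)).
Proof.
split=> [/ext2_eq0_extend ext0 b b_cts|ext].
  (* Joint continuity becomes a norm bound, which is what currying the form into an operator
     requires. *)
  have [M _ bM] := bilinear_schwarz b_cts.
  have [||tau tauE] := dual_bilinear _ _ bM.
  - by move=> v a x y; exact: linearPl.
  - by move=> u a x y; exact: linearPr.
  have [T TE] := ext0 _ Q hQ tau.
  have [B [B_cts BE]] := bilinear_of_operator T.
  by exists B; split=> // x y; rewrite BE TE tauE.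
apply: (extend_ext2_eq0 hQ) => tau.
have [b [b_cts bE]] := bilinear_of_operator tau.
have [B [B_cts BE]] := ext b b_cts.
have [M _ BM] := bilinear_schwarz B_cts.
have [||T TE] := dual_bilinear _ _ BM.
- by move=> v a x y; exact: linearPl.
- by move=> u a x y; exact: linearPr.
by exists T => x y; rewrite TE BE bE.
Qed.
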